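(* Let $X$ be a $T_1$ topological space. Then $X$ is the open continuous compact image of a complete metric space if and only if $X$ is metacompact and Nonempty has a convergent winning strategy in the Choquet game $\mathsf{Ch}(X)$. Moreover, the strategy can be taken to be stationary (i.e. when these conditions hold, Nonempty has a stationary convergent winning strategy in $\mathsf{Ch}(X)$), and the metric space can be taken to have the same weight as $X$.
   Context: A space $X$ is an open continuous compact image of a space $Y$ if there is an open continuous surjection $f\colon Y \to X$ such that $f^{-1}(\{x\})$ is compact for each $x\in X$. A space is metacompact if every open cover has a point-finite open refinement covering the space. The weight of a space is the least cardinality of a basis. The Choquet game $\mathsf{Ch}(X)$ on a topological space $X$ is played by two players, Empty and Nonempty, for $\omega$ rounds. On round $i$, Empty moves first, choosing a point $x_i \in X$ and an open set $U_i$ with $x_i \in U_i$ and, if $i \geq 1$, $U_i \subseteq V_{i-1}$. Then Nonempty responds with an open set $V_i$ such that $x_i \in V_i \subseteq U_i$. Empty wins the play if $\bigcap_{n<\omega} V_n = \varnothing$; otherwise Nonempty wins. A strategy for Nonempty is a function $\mathfrak{S}$ which takes a partial play ending with a move by Empty (recorded as the sequence $\langle x_j,U_j\rangle_{j\le i}$ of Empty's moves) and returns a legal open set $V_i$ for Nonempty to play. It is winning if Nonempty wins every play that follows it. It is stationary if $\mathfrak{S}(\langle x_j,U_j\rangle_{j\le i}) = \mathfrak{S}(\langle x_i,U_i\rangle)$ for every partial play $\langle x_j,U_j\rangle_{j\le i}$ of Empty against $\mathfrak{S}$. It is convergent if for any play $\langle x_i,U_i,V_i\rangle_{i<\omega}$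 following $\mathfrak{S}$, the collection $\{V_i : i<\omega\}$ is a neighborhood basis for any point in $\bigcap_i V_i$. *)

(* Defs.v *)
From HB Require Import structures.
From mathcomp Require Import all_boot all_order all_algebra.
From mathcomp Require Import all_classical all_reals all_analysis.

Set Implicit Arguments.
Unset Strict Implicit.
Unset Printing Implicit Defensive.

Local Open Scope classical_set_scope.
Local Open Scope card_scope.

(* [completeType] and [cvg] require a pointed carrier, which would exclude the
   empty metric space; this is the axiom of [completeType] on an arbitrary
   uniform space. *)
Definition complete_space (Y : uniformType) : Prop :=
  forall F : set_system Y, ProperFilter F -> cauchy F -> exists l : Y, F --> l.

Definition open_continuous_compact_image (Y X : topologicalType) : Prop :=
  exists f : Y -> X,
    [/\ continuous f,
        forall U : set Y, open U -> open (f @` U),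
        set_surj [set: Y] [set: X] f &
        forall x : X, compact (f @^-1` [set x])].

Definition open_cover (X : topologicalType) (C : set (set X)) : Prop :=
  C `<=` open /\ cover C id = [set: X].

Definition refines (X : Type) (D C : set (set X)) : Prop :=
  forall V, D V -> exists2 U, C U & V `<=` U.

Definition point_finite (X : Type) (D : set (set X)) : Prop :=
  forall x : X, finite_set [set V | D V /\ V x].

Definition metacompact (X : topologicalType) : Prop :=
  forall C : set (set X), open_cover C ->
    exists D : set (set X), [/\ open_cover D, refines D C & point_finite D].

Definition least_basis (X : topologicalType) (B : set (set X)) : Prop :=
  basis B /\ forall B' : set (set X), basis B' -> B #<= B'.

(* The weight of a space is the cardinality of any of its least bases. *)
Definition same_weight (X Y : topologicalType) : Prop :=
  exists (B : set (set X)) (C : set (set Y)),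
    [/\ least_basis B, least_basis C & B #= C].

Section Choquet.
Variable X : topologicalType.

Definition move : Type := (X * set X)%type.

(* A strategy is fed the sequence of Empty's moves so far; its values on
   sequences that are not [partial_play]s against it are never used. *)
Definition strategy : Type := seq move -> set X.

(* Nonempty partial plays of Empty against [S], that is, positions of the game
   in which Empty has just moved and Nonempty has so far followed [S]. *)
Inductive partial_play (S : strategy) : seq move -> Prop :=
| partial_play_first (x : X) (U : set X) :
    open U -> U x -> partial_play S [:: (x, U)]
| partial_play_next (s : seq move) (x : X) (U : set X) :
    partial_play S s -> open U -> U x -> U `<=` S s ->
    partial_play S (rcons s (x, U)).

Definition legal_strategy (S : strategy) : Prop :=
  forall (s : seq move) (x : X) (U : set X),
    partial_play S (rcons s (x, U)) ->
    [/\ open (S (rcons s (x, U))), S (rcons s (x, U)) x &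
        S (rcons s (x, U)) `<=` U].

Definition play (x : nat -> X) (U V : nat -> set X) : Prop :=
  [/\ forall i, open (U i) /\ U i (x i),
      forall i, U i.+1 `<=` V i &
      forall i, [/\ open (V i), V i (x i) & V i `<=` U i]].

Definition follows (S : strategy) (x : nat -> X) (U V : nat -> set X) : Prop :=
  play x U V /\ forall i, V i = S (mkseq (fun j => (x j, U j)) i.+1).

Definition winning (S : strategy) : Prop :=
  forall x U V, follows S x U V -> \bigcap_i V i !=set0.

Definition stationary (S : strategy) : Prop :=
  forall (s : seq move) (m : move),
    partial_play S (rcons s m) -> S (rcons s m) = S [:: m].

Definition nbhs_basis (y : X) (B : set (set X)) : Prop :=
  B `<=` nbhs y /\ filter_from B id --> y.

Definition convergent (S : strategy) : Prop :=
  forall x U V, follows S x U V ->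
    forall y, (\bigcap_i V i) y -> nbhs_basis y (range V).

Definition convergent_winning_strategy (S : strategy) : Prop :=
  [/\ legal_strategy S, winning S & convergent S].

End Choquet.

(* Main.v *)
Require Import Defs.
From HB Require Import structures.
From mathcomp Require Import all_boot all_order all_algebra.
From mathcomp Require Import all_classical all_reals all_analysis.
From mathcomp Require Import wochoice lra.

(* If [f : Y -> X] is an open compact map from a complete metric space,
   locally finite refinements in [Y] push forward to point-finite ones in [X],
   and Nonempty wins by a stationary strategy that lets a Cauchy sequence be
   drawn through the fibres of Empty's points, in balls of geometrically
   decreasing radii.

   Conversely, given a metacompact [X] and a convergent winning strategy,
   build point-finite open covers [level 0], [level 1], ... together with a
   point [pick n V] for each [V] in [level n], so that [V] is inside
   Nonempty's answer to Empty playing [pick n V] in every partial play through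
   members of earlier levels whose last set contains [pick n V]. By König's
   lemma the covers form a development, so a sequence [g n] in [level n] has a
   common point iff for every [n] there is [m > n] with [pick m (g m)] in [g
   0], ..., [g n]: such sequences contain plays against the strategy.
   Recording for each [n] the least such [m] turns them into a closed subspace
   of a countable product of discrete spaces, which maps onto [X] by an open
   compact map. *)

Set Implicit Arguments.
Unset Strict Implicit.
Unset Printing Implicit Defensive.

Import Order.TTheory GRing.Theory Num.Theory.

Local Open Scope classical_set_scope.
Local Open Scope card_scope.

(** * Cardinals and König's lemma *)

(** Zorn gives a maximal set [Z] of choice functions on [P] with pairwise distinct values at every
    member of [P]. If [Z] missed a point of every member, these points would form a further
    function. So [Z] exhausts some [B], while evaluation at any [B'] embeds [Z] in [B']. *)
Lemma least_card_ex (T : Type) (P : set (set T)) : P !=set0 ->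
  exists B, P B /\ forall B', P B' -> B #<= B'.
Proof.
move=> [B0 PB0].
pose good (Z : set (set T -> T)) :=
  (forall h, Z h -> forall B, P B -> B (h B)) /\
  (forall h k, Z h -> Z k -> forall B, P B -> h B = k B -> h = k).
have [|Z [[Zin Zinj] Zmax]] := @Zorn_bigcup _ good.
  move=> F Fgood Ftot; split=> [h [Z FZ Zh]|h k [Z FZ Zh] [Z' FZ' Zk]].
    exact: (Fgood _ FZ).1.
  have [ZZ'|Z'Z] := Ftot _ _ FZ FZ'; first exact: (Fgood _ FZ').2 (ZZ' _ Zh) Zk.
  exact: (Fgood _ FZ).2 Zh (Z'Z _ Zk).
have [B PB Bsurj] : exists2 B, P B & forall t, B t -> exists2 h, Z h & h B = t.
  apply: contrapT => /forall2NP noB.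
  have miss B : P B -> exists t, B t /\ forall h, Z h -> h B <> t.
    case: (noB B) => [nPB /nPB //|/existsNP[t /not_implyP[Bt nh]] _].
    by exists t; split=> // h Zh hB; apply: nh; exists h.
  have [t0 _] := miss _ PB0.
  have /choice[h hP] : forall B, exists t, P B -> B t /\ forall h, Z h -> h B <> t.
    move=> B; have [/miss[t tP]|nPB] := pselect (P B); first by exists t.
    by exists t0 => /nPB.
  refine (Zmax (Z `|` [set h]) _ _).
    split=> [k Zk|sub]; first by left.
    by have Zh := sub h (or_intror erefl); apply: (hP _ PB0).2 Zh erefl.
  split=> [k [Zk|->]|k l [Zk|->] [Zl|->]] B PB //.
  - exact: (Zin k Zk B PB).
  - exact: (hP B PB).1.
  - exact: (Zinj k l Zk Zl B PB).
  - by move/(hP _ PB).2: Zk.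
  - by move/esym; move/(hP _ PB).2: Zl.
exists B; split=> // B' PB'.
have -> : B = (fun h : set T -> T => h B) @` Z.
  by apply/seteqP; split=> [t /Bsurj[h Zh <-]|_ [h Zh <-]]; [exists h|exact: (Zin h Zh B PB)].
apply: card_le_trans (card_image_le _ _) _.
have inj : {in Z &, injective (fun h : set T -> T => h B')}.
  by move=> h k /set_mem Zh /set_mem Zk; exact: Zinj.
rewrite -(card_le_eql (inj_card_eq inj)).
by apply: subset_card_le => _ [h Zh <-]; exact: (Zin h Zh B' PB').
Qed.

(** A maximal family [F] of injective sequences in [B] with disjoint ranges leaves only a finite
    remainder [R]. Hence an image of [F] times [nat] covers [B] times [nat], and [F] times [nat]
    embeds in [B] by evaluation. *)
Lemma card_setX_nat_le (T : Type) (B : set T) :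
  infinite_set B -> B `*` [set: nat] #<= B.
Proof.
move=> Binf.
pose good (F : set (nat -> T)) := (forall s, F s -> forall i, B (s i)) /\
  (forall s t, F s -> F t -> forall i j, s i = t j -> s = t /\ i = j).
have [|F [[FB Finj] Fmax]] := @Zorn_bigcup _ good.
  move=> C Cgood Ctot; split=> [s [F CF Fs]|s t [F CF Fs] [F' CF' Ft]].
    exact: (Cgood _ CF).1.
  have [FF'|F'F] := Ctot _ _ CF CF'; first exact: (Cgood _ CF').2 (FF' _ Fs) Ft.
  exact: (Cgood _ CF).2 Fs (F'F _ Ft).
pose R := B `\` \bigcup_(s in F) range s.
have Rfin : finite_set R.
  apply: contrapT => /infiniteP; have [b _] := infinite_setN0 Binf.
  pose pT := HB.pack_for pointedType T (gen_eqMixin T) (gen_choiceMixin T) (isPointed.Build T b).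
  move=> /(@pcard_leP nat pT)/injfunPex[s sR sinj].
  have {}sinj i j : s i = s j -> i = j by apply: sinj; rewrite in_setT.
  refine (Fmax (F `|` [set s]) _ _).
    split=> [t Ft|sub]; first by left.
    by have [_] := sR 0%N Logic.I; apply; exists s; [exact: (sub s (or_intror erefl))|exists 0%N].
  split=> [t [Ft|->] i|t u [Ft|->] [Fu|->] i j].
  - exact: FB.
  - by have [] := sR i Logic.I.
  - exact: Finj.
  - by move=> tu; have [_ []] := sR j Logic.I; exists t => //; exists i.
  - by move=> tu; have [_ []] := sR i Logic.I; exists u => //; exists j.
  - by move=> /sinj.
have [s0 Fs0] : F !=set0.
  apply/set0P/eqP => F0; apply: Binf; suff -> : B = R by [].
  by rewrite /R F0 bigcup_set0 setD0.
have [r rP] : exists r : nat -> T, R `<=` range r.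
  have /finite_set_countable/countable_injP[f finj] := Rfin.
  have /choice[r rP] : forall n, exists t, forall t', R t' -> f t' = n -> t = t'.
    move=> n; have [[t [Rt ft]]|no] := pselect (exists t, R t /\ f t = n).
      exists t => t' Rt' ft'; apply: finj; rewrite ?inE//.
      by rewrite ft ft'.
    by exists (s0 0%N) => t' Rt' ft'; case: no; exists t'.
  by exists r => t Rt; exists (f t) => //; exact: rP.
have le1 : B `*` [set: nat] #<= F `*` [set: nat].
  (* The number codes a triple [(i, b, n)]; the flag [b] chooses between the sequence and the
     enumeration [r] of the remainder. *)
  pose g (p : (nat -> T) * nat) : T * nat :=
    if unpickle p.2 is Some (i, b, n) then (if b : bool then p.1 i else r i, n)
    else (s0 0%N, 0%N).
  apply: card_le_trans (subset_card_le _) (card_image_le g _).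
  move=> [t n] [/= Bt _]; have [[s Fs [i _ st]]|nt] := pselect ((\bigcup_(s in F) range s) t).
    by exists (s, pickle (i, true, n)); rewrite // /g /= pickleK /= st.
  have [//|i _ rt] := rP t _.
  by exists (s0, pickle (i, false, n)); rewrite // /g /= pickleK /= rt.
apply: card_le_trans le1 _.
have inj : {in F `*` [set: nat] &, injective (fun p : (nat -> T) * nat => p.1 p.2)}.
  move=> [s i] [t j] /set_mem[/= Fs _] /set_mem[/= Ft _] /= sitj.
  by have [-> ->] := Finj _ _ Fs Ft _ _ sitj.
rewrite -(card_le_eql (inj_card_eq inj)).
by apply: subset_card_le => _ [[s i] [/= Fs _] <-]; exact: FB.
Qed.

(** Otherwise every [p] in [A] fails at some stage [m p]; as [Q] decreases, all fail at the maximum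
    of these stages. *)
Lemma finite_set_pigeonhole (T : Type) (A : set T) (Q : nat -> T -> Prop) :
  finite_set A -> (forall m p, Q m.+1 p -> Q m p) ->
  (forall m, exists2 p, A p & Q m p) -> exists2 p, A p & forall m, Q m p.
Proof.
elim/Peq: T => T in A Q *; move=> /finite_seqP[s ->] Qdec Qex; apply: contrapT.
move=> /forall2NP no.
have /choice[m mP] : forall p, exists m, p \in s -> ~ Q m p.
  move=> p; case: (no p) => [nsp|/existsNP[m nQ]]; last by exists m.
  by exists 0%N => sp; case: nsp.
have [p sp Qp] := Qex (\max_(p <- s) m p).
apply: (mP p) => //; have {sp} := @leq_bigmax_seq _ s xpredT m p sp isT.
move: (\max_(p <- s) m p) Qp => k Qk mk.
rewrite -(subnK mk) addnC in Qk.
by elim: (k - m p)%N Qk => [|i IH];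
  rewrite ?addn0// addnS => /Qdec.
Qed.

Lemma konig (T : Type) (L : nat -> set T) (E : T -> T -> Prop) :
  (forall n, finite_set (L n)) ->
  (forall n t, L n.+1 t -> exists2 p, L n p & E p t) ->
  (forall n, L n !=set0) ->
  exists b : nat -> T, forall n, L n (b n) /\ E (b n) (b n.+1).
Proof.
move=> Lfin Lpar Lne.
(* [deep m n p]: a chain of [m] edges starts at [p] in level [n]. By pigeonhole, a vertex with
   chains of every length has a successor of the same kind. *)
pose fix deep (m n : nat) (p : T) {struct m} : Prop := L n p /\
  if m is m'.+1 then exists q, E p q /\ deep m' n.+1 q else True.
have deepL m n p : deep m n p -> L n p by case: m => [|m] [].
have deepS m n p : deep m.+1 n p -> deep m n p.
  elim: m n p => [|m IH] n p [Lp [q [Epq dq]]]; split=> //.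
  by exists q; split=> //; exact: IH.
have deepex m n : exists p, deep m n p.
  elim: m n => [|m IH] n; first by have [p Lp] := Lne n; exists p.
  have [q dq] := IH n.+1; have [p Lp Epq] := Lpar _ _ (deepL _ _ _ dq).
  by exists p; split=> //; exists q.
have [p0 _ d0] : exists2 p, L 0%N p & forall m, deep m 0%N p.
  apply: finite_set_pigeonhole => // [m p /deepS//|m].
  by have [p dp] := deepex m 0%N; exists p => //; exact: deepL dp.
have step n p : (forall m, deep m n p) -> exists q, E p q /\ forall m, deep m n.+1 q.
  move=> dp; have [|||q _ qP] := @finite_set_pigeonhole _ (L n.+1)
    (fun m q => E p q /\ deep m n.+1 q).
  - exact: Lfin.
  - by move=> m q [Epq /deepS].
  - move=> m; have [_ [q [Epq dq]]] := dp m.+1.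
    by exists q => //; exact: deepL dq.
  by exists q; split=> [|m]; [exact: (qP 0%N).1|exact: (qP m).2].
pose St := {np : nat * T | forall m, deep m np.1 np.2}.
have /choice[nxt nxtP] : forall z : St, exists w : St,
    (sval w).1 = (sval z).1.+1 /\ E (sval z).2 (sval w).2.
  by move=> [[n p] /= dp]; have [q [Epq dq]] := step _ _ dp; exists (exist _ (n.+1, q) dq).
pose b n := iter n nxt (exist _ (0%N, p0) d0 : St).
have b1 n : (sval (b n)).1 = n by elim: n => [//|n IH]; rewrite [b _]/= (nxtP (b n)).1 IH.
exists (fun n => (sval (b n)).2) => n; split; last exact: (nxtP _).2.
by have := svalP (b n) 0%N; rewrite b1 => -[].
Qed.

Local Open Scope ring_scope.

(** * Metacompactness of open compact images *)

Lemma metric_ball_open (R : realType) (Y : metricType R) (y : Y) (e : R) :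
  open (ball y e).
Proof.
rewrite openE => z; rewrite ballEmdist /= => yz; apply/nbhs_ballP.
exists (e - mdist y z) => /= [|w]; first by rewrite subr_gt0.
by rewrite !ballEmdist /= => zw; have := metric_triangle y z w; lra.
Qed.

Lemma open_ball_subset (R : realType) (Y : pseudoMetricType R) (O : set Y) (y : Y) :
  open O -> O y -> exists2 e : R, 0 < e & ball y e `<=` O.
Proof. by rewrite openE => /[apply] /nbhs_ballP[e e0 eO]; exists e. Qed.

Lemma halfX_gt0 (R : realType) (n : nat) : 0 < 2^-1 ^+ n :> R.
Proof. by rewrite exprn_gt0// invr_gt0. Qed.

Lemma halfXS (R : realType) (n : nat) : 2^-1 ^+ n.+1 + 2^-1 ^+ n.+1 = 2^-1 ^+ n :> R.
Proof. by rewrite exprS; lra. Qed.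

Lemma le_halfX (R : realType) (m n : nat) :
  (m <= n)%N -> 2^-1 ^+ n <= 2^-1 ^+ m :> R.
Proof. by move=> mn; rewrite ler_wiXn2l// ?invr_ge0// invf_le1// ler1n. Qed.

Lemma halfX_lt (R : realType) (e : R) : 0 < e -> exists n : nat, 2^-1 ^+ n < e.
Proof.
move=> e0; have [N _ /(_ N (leqnn N))/=] := near_infty_natSinv_expn_lt (PosNum e0).
by rewrite div1r -exprVn; exists N.
Qed.

(* M. E. Rudin's proof of Stone's theorem. *)
Lemma metric_paracompact (R : realType) (Y : metricType R) (C : set (set Y)) :
  open_cover C -> exists D, [/\ open_cover D, refines D C &
    forall y, exists2 e : R, 0 < e & finite_set [set V | D V /\ V `&` ball y e !=set0]].
Proof.
move=> [Copen Ccov]; pose r n : R := 2^-1 ^+ n.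
have [W Wwo] := well_ordering_principle (set Y).
have /choice[m mP] : forall y, exists U, [/\ C U, U y & forall V, C V -> V y -> W U V].
  move=> y; have : cover C id y by rewrite Ccov.
  move=> [U CU Uy].
  have [|V [[Vin Vmin] _]] := Wwo (fun V => `[< C V /\ V y >]).
    by exists U; rewrite inE.
  move: Vin; rewrite unfold_in => /asboolP[CV Vy]; exists V; split=> // V' CV' V'y.
  by apply: Vmin; rewrite unfold_in; apply/asboolP.
(* Centres of stage [n] avoid all balls of earlier stages. The factor 3 keeps balls of radius [r n]
   for different members of [C] apart. *)
pose center n (E : set Y) := [set x | ~ E x /\ ball x (3 * r n) `<=` m x].
pose fix E n : set Y :=
  if n is n'.+1 then E n' `|` \bigcup_(x in center n' (E n')) ball x (r n') else set0.
pose Dn n U := \bigcup_(x in [set x | center n (E n) x /\ m x = U]) ball x (r n).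
have r0 n : 0 < r n by exact: halfX_gt0.
have Emono i n : (i <= n)%N -> E i `<=` E n.
  by move=> /subnK <-; elim: (n - i)%N => // k IH x /IH; left.
have DnE i n U : (i < n)%N -> Dn i U `<=` E n.
  by move=> ltin x [c [cc _] cx]; apply: (Emono _ _ ltin); right; exists c.
have EDn n x : E n x -> exists i U, C U /\ Dn i U x.
  elim: n => [//|n IH] /= [/IH//|[c cc cx]].
  by exists n, (m c); split; [case: (mP c)|exists c].
have Dncov x : exists i U, C U /\ Dn i U x.
  have [Cm mx _] := mP x; have [e e0 em] := open_ball_subset (Copen _ Cm) mx.
  have e3 : 0 < e / 3 by lra.
  have [n rn] := halfX_lt e3.
  have [/EDn//|nE] := pselect (E n x).
  exists n, (m x); split=> //; exists x; last exact/ballxx.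
  by split=> //; split=> // z; move=> /(le_ball _)-/(_ e) H; apply/em/H; rewrite /r; lra.
have Dnopen n U : open (Dn n U) by apply: bigcup_open => x _; exact: metric_ball_open.
exists [set V | exists n U, C U /\ V = Dn n U]; split.
- split=> [_ [n [U [_ ->]]]//|]; apply/seteqP; split=> // x _.
  by have [i [U [CU Dx]]] := Dncov x; exists (Dn i U) => //; exists i, U.
- move=> _ [n [U [CU ->]]]; exists U => // x [c [[_ cU] <-] cx]; apply: cU.
  by move: cx; apply: le_ball; have := r0 n; lra.
move=> y; have [n [U [CU Dy]]] := Dncov y.
have [e e0 eD] := open_ball_subset (Dnopen n U) Dy; have [j rj] := halfX_lt e0.
(* The ball of radius [r k.+1] meets at most one set of each stage before [k]. It meets none of a
   stage [i] from [k] on, since the centres there avoid [E i], which contains [Dn n U] and so the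
   ball of radius [e] about [y]. *)
pose k := (maxn n j).+1; exists (r k.+1); first exact: r0.
have /choice[g gP] : forall i, exists V, forall U', C U' ->
    Dn i U' `&` ball y (r k.+1) !=set0 -> (i < k)%N -> Dn i U' = V.
  move=> i; have [[U0 [CU0 ne0]]|no] := pselect (exists U',
      C U' /\ Dn i U' `&` ball y (r k.+1) !=set0); last first.
    by exists set0 => U' CU' ne; case: no; exists U'.
  exists (Dn i U0) => U1 CU1 ne1 ltik; congr Dn.
  have Wanti U2 U3 x2 x3 : center i (E i) x2 -> m x2 = U2 -> m x3 = U3 ->
      ball x2 (3 * r i) x3 -> W U3 U2.
    by move=> [_ cx2] <- <- x23; case: (mP x3) => _ _; apply; [case: (mP x2)|exact: cx2].
  have near U2 U3 : Dn i U2 `&` ball y (r k.+1) !=set0 ->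
      Dn i U3 `&` ball y (r k.+1) !=set0 -> W U3 U2.
    move=> [p [[x2 [cx2 mx2] x2p] yp]] [q [[x3 [cx3 mx3] x3q] yq]].
    apply: (Wanti _ _ _ _ cx2 mx2 mx3).
    have := ball_triangle (ball_triangle (ball_triangle x2p (ball_sym yp)) yq) (ball_sym x3q).
    apply: le_ball; have := halfXS R k; have := @le_halfX R _ _ (ltnW ltik).
    by rewrite -/(r k) -/(r k.+1) -/(r i); lra.
  (* Uniqueness of least elements serves as antisymmetry of [W]: both [U0] and [U1] are least in
     their pair. *)
  have [|V [_ Vuniq]] := Wwo (fun V => `[< V = U0 \/ V = U1 >]).
    by exists U0; rewrite unfold_in; apply/asboolP; left.
  have VE U2 : U2 = U0 \/ U2 = U1 -> V = U2.
    move=> U2P; apply: Vuniq; split; first by rewrite unfold_in; apply/asboolP.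
    move=> V'; rewrite unfold_in => /asboolP V'P.
    by case: U2P => ->; case: V'P => ->; exact: near.
  by rewrite -(VE U0 (or_introl erefl)) -(VE U1 (or_intror erefl)).
apply: sub_finite_set (finite_image g (finite_II k)).
move=> _ [[i [V [CV ->]]] ne]; have [ltik|leki] := ltnP i k.
  by exists i => //; apply/esym; apply: gP.
case: ne => z [[x [[nEx _] _] xz] yz]; exfalso; apply: nEx.
have ltni : (n < i)%N by apply: leq_trans leki; rewrite ltnS leq_maxl.
apply: (DnE _ _ _ ltni); apply: eD.
have := ball_triangle yz (ball_sym xz); apply: le_ball.
have : r i <= r k by exact: le_halfX.
have : r k <= r j.+1 by apply: le_halfX; rewrite ltnS leq_maxr.
have := halfXS R j; have := halfXS R k; have := r0 k.+1.
by rewrite -/(r k) -/(r k.+1) -/(r j) -/(r j.+1); move: rj; rewrite -/(r j); lra.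
Qed.

Lemma compact_finite_meet (T : topologicalType) (D : set (set T)) (K : set T) :
  compact K ->
  (forall y, K y -> exists2 O, nbhs y O & finite_set [set V | D V /\ V `&` O !=set0]) ->
  finite_set [set V | D V /\ V `&` K !=set0].
Proof.
move=> /compact_near_coveringP Kcov Dlf.
(* With this filter of families containing a large finite one, the near-covering form of compactness
   merges the local finite families into a single one. *)
pose F := filter_from (@finite_set (set T)) (fun E => [set E' | E `<=` E']).
have FF : Filter F.
  apply: filter_from_filter; first by exists set0.
  move=> E E' Efin E'fin; exists (E `|` E'); first by rewrite finite_setU.
  by move=> G EG; split=> x ?; apply: EG; [left|right].
have [|E Efin /(_ E)KE] := Kcov _ F (fun E y => forall V, D V -> V y -> E V).
  move=> y Ky; have [N yN Nfin] := Dlf y Ky.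
  exists (N, [set E' | [set V | D V /\ V `&` N !=set0] `<=` E']).
    by split=> //; exists [set V | D V /\ V `&` N !=set0].
  move=> [z E'] [/= Oz E'P] V DV Vz; apply: E'P; split=> //.
  by exists z.
apply: (sub_finite_set _ Efin) => V [DV [z [Vz Kz]]].
by apply: (KE _ z).
Qed.

(** The image of [V] contains [x] exactly when [V] meets the compact fibre of [x], which only
    finitely many members of a locally finite family do. *)
Lemma open_compact_image_metacompact (R : realType) (Y : metricType R)
    (X : topologicalType) : open_continuous_compact_image Y X -> metacompact X.
Proof.
move=> [f [fcont fopen fsurj fcomp]] C [Copen Ccov].
have [|D [[Dopen Dcov] Dref Dlf]] := @metric_paracompact _ Y [set f @^-1` U | U in C].
  split=> [_ [U CU <-]|].
    by apply: open_comp; [move=> y _; exact: fcont|exact: Copen].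
  apply/seteqP; split=> // y _; have [U CU Uy] : cover C id (f y) by rewrite Ccov.
  by exists (f @^-1` U) => //; exists U.
exists [set f @` V | V in D]; split.
- split=> [_ [V DV <-]|]; first exact/fopen/Dopen.
  apply/seteqP; split=> // x _; have [//|y _ <-] := fsurj x.
  have [V DV Vy] : cover D id y by rewrite Dcov.
  by exists (f @` V); [exists V|exists y].
- move=> _ [V DV <-]; have [_ [U CU <-] VU] := Dref V DV.
  by exists U => // _ [y Vy <-]; exact: VU.
move=> x; pose K := f @^-1` [set x].
have Kfin : finite_set [set V | D V /\ V `&` K !=set0].
  apply: compact_finite_meet; first exact: fcomp.
  by move=> y _; have [e e0 efin] := Dlf y; exists (ball y e) => //; exact: nbhsx_ballx.
apply: sub_finite_set (finite_image (fun V => f @` V) Kfin).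
by move=> _ [[V DV <-] [y Vy yx]]; exists V => //; split=> //; exists y.
Qed.

(** * Stationary strategies on open compact images *)

Lemma compact_uniform_ball (R : realType) (Y : pseudoMetricType R) (K O : set Y) :
  compact K -> open O -> K `<=` O ->
  exists2 e : R, 0 < e & forall y, K y -> ball y e `<=` O.
Proof.
move=> /compact_near_coveringP Kcov Oopen KO.
have [|N _ /(_ N (leqnn N)) NP] := Kcov nat \oo (fun n y => ball y (2^-1 ^+ n : R) `<=` O).
  move=> y Ky; have [e e0 eO] := open_ball_subset Oopen (KO _ Ky).
  have e2 : 0 < e / 2 by lra.
  have [N Ne] := halfX_lt e2.
  exists (ball y (2^-1 ^+ N : R), [set n | (N <= n)%N]).
    by split; [exact/nbhsx_ballx/halfX_gt0|exists N].
  move=> [w n] [/= yw Nn] v wv; apply: eO.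
  have := ball_triangle yw wv; apply: le_ball.
  by have := @le_halfX R _ _ Nn; lra.
by exists (2^-1 ^+ N); [exact: halfX_gt0|exact: NP].
Qed.

Lemma partial_play_last (X : topologicalType) (S : strategy X) s x U :
  partial_play S (rcons s (x, U)) -> open U /\ U x.
Proof.
move E: (rcons s (x, U)) => t tP.
by case: tP E => [y V Vo Vy|t' y V _ Vo Vy _] /(congr1 (last (x, U)));
  rewrite !last_rcons => -[-> ->].
Qed.

Section stationary.
Variables (R : realType) (Y : metricType R) (X : topologicalType).
Hypotheses (XT1 : accessible_space X) (Ycomplete : complete_space Y).
Variable f : Y -> X.
Hypotheses (fcont : continuous f) (fopen : forall U : set Y, open U -> open (f @` U)).
Hypotheses (fsurj : set_surj [set: Y] [set: X] f).
Hypotheses (fcomp : forall x : X, compact (f @^-1` [set x])).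

(* Answering [(x, U)] by the points all of whose fibres come [r]-close to
   every point of the fibre of [x] makes the radii of a play shrink by a
   factor 4: if [U] sits inside such an answer of radius [s], then [U] is
   inside the image of a ball of radius [2 * s] centred in the fibre of [x],
   so [8 * r <= 2 * s]. *)
Let admissible_radius x (U : set X) (r : R) := [/\ 0 < r,
  forall y, f y = x -> ball y (2 * r) `<=` f @^-1` U &
  U = [set x] \/
  forall rho y, f y = x -> U `<=` f @` ball y rho -> 8 * r <= rho].

(** A second point [z] of [U] gives the lower bound on [rho]: as points are closed, balls of some
    radius [d] about the fibre of [x] miss the fibre of [z], so a ball whose image covers [U] has
    radius at least [d]. For [U = [set x]] there is no such [z], hence the separate alternative. *)
Let admissible_radius_ex x (U : set X) : open U -> U x ->
  exists r, admissible_radius x U r.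
Proof.
move=> Uopen Ux.
have [e e0 eU] : exists2 e : R, 0 < e & forall y, f y = x -> ball y e `<=` f @^-1` U.
  have [||e e0 eU] := @compact_uniform_ball R Y _ (f @^-1` U) (@fcomp x).
  - by apply: open_comp => // y _; exact: fcont.
  - by move=> y /= ->.
  - by exists e.
have [Ux1|Ux1] := pselect (U = [set x]).
  exists (e / 2); split; [lra| |by left].
  by move=> y /eU; rewrite mulrC divfK.
have [z [Uz zx]] : exists z, U z /\ z <> x.
  apply: contrapT => /forallNP no; apply: Ux1; apply/seteqP; split=> [z Uz|_ ->//].
  by apply: contrapT => zx; apply: (no z).
have [d d0 dz] : exists2 d : R, 0 < d & forall y, f y = x -> ball y d `<=` f @^-1` (~` [set z]).
  have [||d d0 dz] := @compact_uniform_ball R Y _ (f @^-1` (~` [set z])) (@fcomp x).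
  - apply: open_comp => [y _|]; first exact: fcont.
    exact/closed_openC/accessible_closed_set1.
  - by move=> y /= -> /esym.
  - by exists d.
exists (Num.min (e / 2) (d / 8)); split.
- by rewrite lt_min; apply/andP; split; lra.
- move=> y /eU ey w yw; apply: ey; move: yw; apply: le_ball.
  have : Num.min (e / 2) (d / 8) <= e / 2 by rewrite ge_min lexx.
  lra.
- right=> rho y yx Urho; have : Num.min (e / 2) (d / 8) <= d / 8 by rewrite ge_min lexx orbT.
  have : d <= rho; last lra.
  rewrite leNgt; apply/negP => /ltW rhod.
  by have [w yw wz] := Urho _ Uz; apply: (dz y yx w _ wz); exact: le_ball yw.
Qed.

Let radius x U : R := xget 0 (admissible_radius x U).

Let radiusP x (U : set X) : open U -> U x -> admissible_radius x U (radius x U).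
Proof.
by move=> Uopen Ux; have [r rP] := admissible_radius_ex Uopen Ux; apply: xgetI rP.
Qed.

Let hits x r := [set z | forall y, f y = x -> exists2 w, f w = z & ball y r w].

(** Near a point of the fibre, the image of the ball of radius [r / 2] is an open set around [x]
    whose points are reached within [r] from anywhere in that ball. Compactness of the fibre makes
    this uniform. *)
Let nbhs_hits x (r : R) : 0 < r -> nbhs x (hits x r).
Proof.
move=> r0; have /compact_near_coveringP Kcov := @fcomp x.
apply: (Kcov X (nbhs x) (fun z y => exists2 w, f w = z & ball y r w)) => y yx.
have r2 : 0 < r / 2 by lra.
exists (ball y (r / 2), f @` ball y (r / 2)).
  split=> /=; first exact: nbhsx_ballx.
  apply: open_nbhs_nbhs; split; first exact/fopen/metric_ball_open.
  by exists y => //; exact: ballxx.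
move=> [y' z] [/= yy' [w yw wz]]; exists w => //.
have := ball_triangle (ball_sym yy') yw; apply: le_ball; lra.
Qed.

Let reply (m : move X) : set X := m.2 `&` (hits m.1 (radius m.1 m.2))^°.

Let strat (s : seq (move X)) : set X := if s is m :: s' then reply (last m s') else setT.

Let strat_rcons s m : strat (rcons s m) = reply m.
Proof. by case: s => [//|m' s] /=; rewrite last_rcons. Qed.

Let strat_legal : legal_strategy strat.
Proof.
move=> s x U sP; have [Uopen Ux] := partial_play_last sP.
have [r0 _ _] := radiusP Uopen Ux.
rewrite strat_rcons; split; last by move=> z [].
- by apply: openI => //; exact: open_interior.
- by split=> //; exact: nbhs_hits.
Qed.

Section one_play.
Variables (x : nat -> X) (U V : nat -> set X).
Hypothesis SxUV : follows strat x U V.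

Let r i := radius (x i) (U i).

Let UopenP i : open (U i) /\ U i (x i). Proof. by have [[]] := SxUV. Qed.

Let UV i : U i.+1 `<=` V i. Proof. by have [[]] := SxUV. Qed.

Let VE i : V i = reply (x i, U i).
Proof. by have [_ ->] := SxUV; rewrite mkseqS strat_rcons. Qed.

Let VU i : V i `<=` U i. Proof. by rewrite VE => z []. Qed.

Let Vhits i : V i `<=` hits (x i) (r i).
Proof. by rewrite VE => z [_ /interior_subset]. Qed.

Let Udec i j : (i <= j)%N -> U j `<=` U i.
Proof. by move=> /subnK <-; elim: (j - i)%N => // k IH z /UV/VU/IH. Qed.

(** Unless some [U i] is a singleton, the radii shrink geometrically. Points [y i] over [x i], each
    within [r i] of the next, then form a Cauchy sequence, and the image of its limit is the only
    point common to all [V i]. *)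
Lemma play_limit : exists z, (forall i, V i z) /\
  forall z', (forall i, V i z') -> forall W, nbhs z' W -> exists i, V i `<=` W.
Proof.
have Vx i : V i (x i) by have [[_ _ /(_ i)[]]] := SxUV.
have [[i Ui]|noi] := pselect (exists i, U i = [set x i]).
  exists (x i); split=> [j|z' Vz' W W1]; last first.
    exists i => z /VU; rewrite Ui => ->.
    by have := VU (Vz' i); rewrite Ui => <-; exact: nbhs_singleton.
  have [ij|ji] := leqP i j.
    have : U i (x j) by apply: (Udec ij); case: (UopenP j).
    by rewrite Ui => <-.
  by apply: UV; apply: (Udec ji); case: (UopenP i).
have rP i : [/\ 0 < r i, forall y, f y = x i -> ball y (2 * r i) `<=` f @^-1` (U i) &
    forall rho y, f y = x i -> U i `<=` f @` ball y rho -> 8 * r i <= rho].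
  have [Uo Ux] := UopenP i; have [r0 rU [U1|rr]] := radiusP Uo Ux => //.
  by case: noi; exists i.
have rdec i : 4 * r i.+1 <= r i.
  have [_ _ rr] := rP i.+1.
  have [//|y _ yx] := @fsurj (x i) _.
  have [w wx yw] := Vhits (UV (UopenP i.+1).2) yx.
  suff : 8 * r i.+1 <= 2 * r i by lra.
  apply: (rr _ w wx) => z /UV/Vhits/(_ _ yx)[v vz yv]; exists v => //.
  have := ball_triangle (ball_sym yw) yv; apply: le_ball; lra.
have rlim e : 0 < e -> exists i, r i < e.
  move=> e0; have r00 : 0 < r 0%N by case: (rP 0%N).
  have rle i : r i <= 2^-1 ^+ i * r 0%N.
    elim: i => [|i IH]; first by rewrite expr0 mul1r.
    by have := halfXS R i; have := rdec i; have [] := rP i.+1; rewrite -(halfXS R i) in IH; nra.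
  have [i ie] := @halfX_lt R (e / r 0%N) (divr_gt0 e0 r00).
  by exists i; apply: le_lt_trans (rle i) _; rewrite -ltr_pdivlMr.
have /choice[nxt nxtP] : forall iy : nat * Y, exists w, f iy.2 = x iy.1 ->
    f w = x iy.1.+1 /\ ball iy.2 (r iy.1) w.
  move=> [i y] /=; have [yx|] := pselect (f y = x i); last by exists y.
  by have [w wx yw] := Vhits (UV (UopenP i.+1).2) yx; exists w.
have [//|y0 _ y0x] := @fsurj (x 0%N) _.
pose y := fix y i := if i is i'.+1 then nxt (i', y i') else y0.
have yx i : f (y i) = x i.
  by elim: i => [//|i IH] /=; have [] := nxtP (i, y i) IH.
have yS i : ball (y i) (r i) (y i.+1) by have [] := nxtP (i, y i) (yx i).
(* [4 / 3] is the sum of the geometric series of ratio [1 / 4]. *)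
have ytail i j : (i <= j)%N -> ball (y i) (4 / 3 * r i) (y j).
  move=> /subnK <-; move: (j - i)%N => k; elim: k i => [|k IH] i.
    by rewrite add0n; apply: ballxx; have [] := rP i; lra.
  have := ball_triangle (yS i) (IH i.+1); rewrite addnS addSn; apply: le_ball.
  by have := rdec i; lra.
have [l yl] : exists l : Y, y @ \oo --> l.
  apply: (@Ycomplete (y @ \oo)); apply/cauchyP => e e0.
  have e2 : 0 < e / 2 by lra.
  have [i ri] := rlim _ e2; exists (y i); exists i => // j /= ij.
  by have := ytail _ _ ij; apply: le_ball; lra.
have ly i : ball l (2 * r i) (y i).
  have [r0 _ _] := rP i; have r3 : 0 < r i / 3 by lra.
  have [N _ NP] := yl _ (nbhsx_ballx l _ r3).
  have := ball_triangle (NP (maxn N i) (leq_maxl _ _)) (ball_sym (ytail i _ (leq_maxr N i))).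
  by apply: le_ball; lra.
exists (f l); split=> [i|z' Vz' W z'W].
  by apply: UV; have [_ rU _] := rP i.+1; apply: (rU _ (yx i.+1)); exact/ball_sym/ly.
have lnear (O : set Y) : open O -> O l -> exists i, ball (y i) (r i) `<=` O.
  move=> Oo Ol; have [e e0 eO] := open_ball_subset Oo Ol.
  have e3 : 0 < e / 3 by lra.
  have [i ri] := rlim _ e3; exists i => w yw; apply: eO.
  by have := ball_triangle (ly i) yw; apply: le_ball; lra.
(* Each small ball about [y i] contains a preimage of [z'], so preimages of [z'] converge to [l];
   points of [X] are closed. *)
have zl : z' = f l.
  apply: contrapT => zfl.
  have [||i iO] := lnear (f @^-1` (~` [set z'])).
  - apply: open_comp => [w _|]; first exact: fcont.
    exact/closed_openC/accessible_closed_set1.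
  - by move=> /esym.
  - by have [w wz yw] := Vhits (Vz' i) (yx i); exact: iO _ yw wz.
have [||i iW] := lnear (f @^-1` W^°).
- apply: open_comp => [w _|]; first exact: fcont.
  exact: open_interior.
- by rewrite /= -zl.
exists i => z /Vhits /(_ _ (yx i))[w <- yw].
by apply: interior_subset; exact: iW.
Qed.

End one_play.

Lemma stationary_strategy_of_image :
  exists S : strategy X, convergent_winning_strategy S /\ stationary S.
Proof.
exists strat; split; last by move=> s m _; rewrite strat_rcons.
split=> [|x U V SxUV|x U V SxUV y yV].
- exact: strat_legal.
- by have [z [Vz _]] := play_limit SxUV; exists z => i _.
have [[_ _ VP] _] := SxUV; split=> [_ [i _ <-]|W yW].
  by apply: open_nbhs_nbhs; split; [case: (VP i)|exact: yV].
have [z [_ zlim]] := play_limit SxUV.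
by have [|i iW] := zlim y _ W yW; [move=> i; exact: yV|exists (V i)].
Qed.

End stationary.

(** * Metric spaces of sequences *)

(** Carrying [R] in the type lets inference find the [R]-valued metric on it. *)
Definition seq_space (R : realType) (Z : Type) (P : (nat -> Z) -> Prop) : Type :=
  {z : nat -> Z | P z}.

Lemma ultra_finite_fibre (T Z : Type) (F : set_system T) (g : T -> Z) (A : set Z) :
  UltraFilter F -> finite_set A -> F (g @^-1` A) -> exists a, F [set u | g u = a].
Proof.
elim/Peq: Z => Z in g A *; move=> FU /finite_seqP[s ->].
elim: s => [|a s IH] FA; first by have [] := filter_ex FA.
have [Fa|FNa] := in_ultra_setVsetC [set u | g u = a] FU; first by exists a.
apply: IH; apply: filterS (filterI FA FNa) => u [/= + ga].
by rewrite inE => /orP[/eqP|].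
Qed.

Section seq_space.
Variables (R : realType) (Z : Type) (P : (nat -> Z) -> Prop).
Local Notation Y := (seq_space R P).

Definition agree (n : nat) (u v : Y) := forall i, (i < n)%N -> sval u i = sval v i.

Lemma seq_space_ext (u v : Y) : (forall n, sval u n = sval v n) -> u = v.
Proof.
move: u v => [u Pu] [v Pv] /= uv; have {}uv : u = v by exact/funext.
by subst v; congr exist; exact: Prop_irrelevance.
Qed.

(** The usual ultrametric on a product of discrete spaces; the default [0] is the distance between
    equal sequences. *)
Definition seq_dist (u v : Y) : R :=
  xget 0 [set r | exists n, [/\ agree n u v, sval u n <> sval v n & r = 2^-1 ^+ n]].

Lemma seq_distP (u v : Y) : (u = v /\ seq_dist u v = 0) \/
  exists n, [/\ agree n u v, sval u n <> sval v n & seq_dist u v = 2^-1 ^+ n].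
Proof.
have [<-|neq] := pselect (u = v).
  by left; split=> //; apply: xgetPN => r [n [_ /(_ erefl)]].
right; have ex : exists n, `[< sval u n <> sval v n >].
  apply: contrapT => /forallNP no; apply: neq; apply: seq_space_ext => n.
  by apply: contrapT => uv; apply: (no n); apply/asboolP.
pose n := ex_minn ex.
have [neqn ag] : sval u n <> sval v n /\ agree n u v.
  rewrite /n; case: ex_minnP => m /asboolP um mmin; split=> // i im.
  by apply: contrapT => /asboolP /mmin; rewrite leqNgt im.
have : [set r | exists n, [/\ agree n u v, sval u n <> sval v n & r = 2^-1 ^+ n :> R]] (2^-1 ^+ n).
  by exists n.
by move=> /(@xgetI _ 0)[m mP]; exists m.
Qed.

Lemma seq_distxx (u : Y) : seq_dist u u = 0.
Proof. by have [[]|[n [_ /(_ erefl)]]] := seq_distP u u. Qed.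

Lemma seq_dist_positivity (u v : Y) : seq_dist u v = 0 -> u = v.
Proof.
by have [[]|[n [_ _ ->]] /eqP] := seq_distP u v => //; rewrite gt_eqF// halfX_gt0.
Qed.

Lemma seq_dist_le (n : nat) (u v : Y) : seq_dist u v <= 2^-1 ^+ n <-> agree n u v.
Proof.
split=> [le i ltin|ag].
  have [[-> _]//|[m [ag um mE]]] := seq_distP u v.
  apply: ag; apply: leq_trans ltin _; rewrite leqNgt; apply/negP => ltmn.
  have := @le_halfX R _ _ ltmn; have := halfXS R m; have := halfX_gt0 R m.
  by move: le; rewrite mE; lra.
have [[_ ->]|[m [_ um ->]]] := seq_distP u v; first exact/ltW/halfX_gt0.
by apply: le_halfX; rewrite leqNgt; apply/negP => /ag.
Qed.

Lemma seq_dist_sym (u v : Y) : seq_dist u v = seq_dist v u.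
Proof.
have agC n w w' : agree n w w' -> agree n w' w by move=> ag i /ag.
have le w w' : seq_dist w w' <= seq_dist w' w.
  have [[-> _]//|[n [ag _ ->]]] := seq_distP w' w.
  by apply/seq_dist_le/agC.
by apply/eqP; rewrite eq_le !le.
Qed.

(** At the first place where [u] and [w] differ, [v] differs from one of them, so one summand is
    already large enough. *)
Lemma seq_dist_triangle (v u w : Y) : seq_dist u w <= seq_dist u v + seq_dist v w.
Proof.
have d0 (u' v' : Y) : 0 <= seq_dist u' v'.
  by have [[_ ->]|[n [_ _ ->]]] := seq_distP u' v'; [|exact/ltW/halfX_gt0].
have [[_ ->]|[n [_ uwn ->]]] := seq_distP u w; first exact: addr_ge0.
have far (u' v' : Y) : sval u' n <> sval v' n -> 2^-1 ^+ n <= seq_dist u' v'.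
  have [[-> _]|[m [ag _ ->]] neq] := seq_distP u' v'; first by case.
  by apply: le_halfX; rewrite leqNgt; apply/negP => /ag.
have [uv|uv] := pselect (sval u n = sval v n).
  by rewrite uv in uwn; have := far _ _ uwn; have := d0 u v; lra.
by have := far _ _ uv; have := d0 v w; lra.
Qed.

HB.instance Definition _ := gen_eqMixin Y.
HB.instance Definition _ := gen_choiceMixin Y.
HB.instance Definition _ := @isMetric.Build R Y seq_dist
  seq_distxx seq_dist_positivity seq_dist_sym seq_dist_triangle.

Lemma seq_nbhsP (u : Y) (A : set Y) : nbhs u A <-> exists n, agree n u `<=` A.
Proof.
rewrite nbhs_ballP; split=> [[e /= e0 eA]|[n nA]].
  have [n ne] := halfX_lt e0; exists n => v /seq_dist_le uv; apply: eA.
  by rewrite ballEmdist /=; exact: le_lt_trans uv ne.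
exists (2^-1 ^+ n) => [|v]; first exact: halfX_gt0.
by rewrite ballEmdist /= => /ltW /seq_dist_le; exact: nA.
Qed.

Lemma agree_open (n : nat) (u : Y) : open (agree n u).
Proof.
rewrite openE => v uv; apply/seq_nbhsP; exists n => w vw i ltin.
by rewrite uv// vw.
Qed.

(** Closedness of [P] in the product of discrete spaces, in terms of finite approximations. *)
Hypothesis Pclosed : forall z : nat -> Z,
  (forall n, exists u : Y, forall i, (i < n)%N -> sval u i = z i) -> P z.

Lemma seq_space_complete : complete_space Y.
Proof.
move=> F FF /cauchyP Fc.
have /choice[u uF] : forall n, exists u, F (agree n u).
  move=> n; have [u uF] := Fc _ (halfX_gt0 R n); exists u.
  by apply: filterS uF => v; rewrite ballEmdist /= => /ltW /seq_dist_le.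
pose z i := sval (u i.+1) i.
have uz n i : (i < n)%N -> sval (u n) i = z i.
  move=> ltin; have [v [uv uv']] := filter_ex (filterI (uF n) (uF i.+1)).
  by rewrite uv// /z uv'.
have Pz : P z by apply: Pclosed => n; exists (u n); exact: uz.
exists (exist _ z Pz : Y) => A /seq_nbhsP[n nA]; apply: filterS (uF n) => v uv.
by apply: nA => i ltin /=; rewrite -uv// uz.
Qed.

(** An ultrafilter on [K] fixes every coordinate, since each takes finitely many values on [K]; the
    sequence of fixed values is its limit. *)
Lemma seq_space_compact (K : set Y) (A : nat -> set Z) :
  (forall n, finite_set (A n)) -> (forall u, K u -> forall n, A n (sval u n)) ->
  (forall u, (forall n, exists2 v, K v & agree n v u) -> K u) -> compact K.
Proof.
move=> Afin KA Kclosed; rewrite compact_ultra => F FU FK.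
have /choice[z zF] : forall n, exists a, F [set u | sval u n = a].
  move=> n; apply: ultra_finite_fibre (Afin n) _.
  by apply: filterS FK => u Ku; exact: KA.
have agF n : F [set u : Y | forall i, (i < n)%N -> sval u i = z i].
  elim: n => [|n IH]; first exact: filterE.
  apply: filterS (filterI IH (zF n)) => u [ui un] i; rewrite ltnS leq_eqVlt.
  by move=> /orP[/eqP->//|/ui].
have agK n : exists u, K u /\ forall i, (i < n)%N -> sval u i = z i.
  by have [u [Ku uz]] := filter_ex (filterI FK (agF n)); exists u.
have Pz : P z by apply: Pclosed => n; have [u [_ uz]] := agK n; exists u.
exists (exist _ z Pz); split.
  by apply: Kclosed => n; have [u [Ku uz]] := agK n; exists u.
move=> B /seq_nbhsP[n nB]; apply: filterS (agF n) => u uz.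
by apply: nB => i ltin; rewrite uz.
Qed.

End seq_space.

Local Close Scope ring_scope.

(** * The metric space of threads *)

Lemma finite_bigcap_nbhs (T I : Type) (F : set_system T) (A : set I) (g : I -> set T) :
  Filter F -> finite_set A -> (forall i, A i -> F (g i)) -> F (\bigcap_(i in A) g i).
Proof.
elim/Peq: I => I in A g *; move=> FF /finite_seqP[s ->].
elim: s => [|i s IH] Fg; first by apply: filterS filterT => t _ j.
have Fs : F (\bigcap_(j in [set` s]) g j).
  by apply: IH => j js; apply: Fg; rewrite /= inE js orbT.
have Fi : F (g i) by apply: Fg; rewrite /= inE eqxx.
apply: filterS (filterI Fi Fs) => t [ti ts] j /=.
by rewrite inE => /orP[/eqP->|/ts].
Qed.

Section positions.
Variables (X : topologicalType) (S : strategy X).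
Hypotheses (XT1 : accessible_space X) (Xmeta : metacompact X).
Hypothesis SP : convergent_winning_strategy S.
Variable x0 : X.

(* [(s, U)] stands for the partial play [s] together with an open set [U]
   inside Nonempty's last answer. *)
Definition position : Type := (seq (move X) * set X)%type.

Definition valid (p : position) :=
  (p.1 = [::] /\ p.2 = setT) \/
  [/\ partial_play S p.1, open p.2 & p.2 `<=` S p.1].

Lemma valid_open p : valid p -> open p.2.
Proof. by case=> [[_ ->]|[]//]; exact: openT. Qed.

Lemma valid_next p x : valid p -> p.2 x -> partial_play S (rcons p.1 (x, p.2)).
Proof.
move: p => [s U] /= [[/= -> ->] _|[/= sP Uo US] Ux].
  by apply: partial_play_first => //; exact: openT.
exact: partial_play_next.
Qed.

Lemma valid_reply p x : valid p -> p.2 x ->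
  [/\ open (S (rcons p.1 (x, p.2))), S (rcons p.1 (x, p.2)) x &
      S (rcons p.1 (x, p.2)) `<=` p.2].
Proof. by move=> pv px; have [Sl _ _] := SP; apply: Sl; exact: valid_next. Qed.

(** Such a chain is a play against [S] in which Empty plays [(y i, (b i).2)]. The sets [(b i).2]
    interleave with Nonempty's answers, so they inherit the common point and the convergence. *)
Lemma position_branch (b : nat -> position) (y : nat -> X) :
  (b 0%N).1 = [::] -> (forall i, valid (b i)) -> (forall i, (b i).2 (y i)) ->
  (forall i, (b i.+1).1 = rcons (b i).1 (y i, (b i).2)) ->
  (forall i, (b i.+1).2 `<=` S (b i.+1).1) ->
  (exists z, forall i, (b i).2 z) /\
  forall z, (forall i, (b i).2 z) -> forall W, nbhs z W -> exists i, (b i).2 `<=` W.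
Proof.
move=> b0 bv by_ bS bsub.
have bE i : (b i).1 = mkseq (fun j => (y j, (b j).2)) i.
  by elim: i => [//|i IH]; rewrite bS IH mkseqS.
have SF : follows S y (fun i => (b i).2) (fun i => S (b i.+1).1).
  split=> [|i]; last by rewrite bE.
  split=> i; first by split; [exact: valid_open|].
    exact: bsub.
  by rewrite bS; apply: valid_reply.
have [_ Sw Sc] := SP; have bS2 i : S (b i.+1).1 `<=` (b i).2.
  by rewrite bS; have [] := valid_reply (bv i) (by_ i).
split=> [|z bz W zW].
  by have [z Vz] := Sw _ _ _ SF; exists z => i; apply: bS2; exact: Vz.
have [|_ /(_ W zW)[_ [i _ <-] SW]] := Sc _ _ _ SF z; first by move=> i _; apply: bsub.
by exists i.+1; exact: subset_trans (bsub i) SW.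
Qed.

(** Finiteness over each point makes the intersection of Nonempty's answers in [refining_ex] a
    neighbourhood. *)
Definition good_family (P : set position) := (forall p, P p -> valid p) /\
  forall x, finite_set [set p | P p /\ p.2 x].

Definition refining (P : set position) (Dc : set (set X) * (set X -> X)) :=
  [/\ open_cover Dc.1, point_finite Dc.1 & forall V p, Dc.1 V -> P p ->
    p.2 (Dc.2 V) -> V `<=` S (rcons p.1 (Dc.2 V, p.2))].

Lemma refining_ex P : good_family P -> exists Dc, refining P Dc.
Proof.
move=> [Pv Pfin].
pose W x := (\bigcap_(p in [set p | P p /\ p.2 x]) S (rcons p.1 (x, p.2)))^°.
have Wx x : W x x.
  apply: finite_bigcap_nbhs => // p [Pp px].
  have [So Sx _] := valid_reply (Pv _ Pp) px.
  exact: open_nbhs_nbhs.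
have [|D [Dcov Dref Dfin]] := Xmeta (C := range W).
  split=> [_ [x _ <-]|]; first exact: open_interior.
  by apply/seteqP; split=> // x _; exists (W x).
(* The point [c V] need not lie in [V]; it only satisfies that [V] is inside [W (c V)]. *)
have /choice[c cP] : forall V, exists x, D V -> V `<=` W x.
  move=> V; have [/Dref[_ [x _ <-] VW]|nDV] := pselect (D V); first by exists x.
  by exists x0.
exists (D, c); split=> //= V p DV Pp pc z /(cP _ DV)/interior_subset.
by apply.
Qed.

(** Old positions are kept, so that a play may skip levels. *)
Definition next_family (P : set position) (Dc : set (set X) * (set X -> X)) :=
  P `|` [set q | exists V p, [/\ Dc.1 V, P p, p.2 (Dc.2 V) &
    q = (rcons p.1 (Dc.2 V, p.2), V)]].

(** A new position over [x] comes from one of the finitely many [V] containing [x] and one of the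
    finitely many old positions over the point attached to [V]. *)
Lemma next_family_good P Dc : good_family P -> refining P Dc ->
  good_family (next_family P Dc).
Proof.
move=> [Pv Pfin] [[Dopen Dcov] Dfin Dref]; split=> [q [/Pv//|[V [p [DV Pp pc ->]]]]|x].
  right; split; [exact: valid_next (Pv _ Pp) pc|exact: Dopen|exact: Dref].
pose g (Vp : set X * position) : position :=
  (rcons Vp.2.1 (Dc.2 Vp.1, Vp.2.2), Vp.1).
apply: (@sub_finite_set _ _ ([set p | P p /\ p.2 x] `|`
    g @` \bigcup_(V in [set V | Dc.1 V /\ V x])
      [set Vp | Vp.1 = V /\ (P Vp.2 /\ Vp.2.2 (Dc.2 V))])).
  move=> q [[Pq|[V [p [DV Pp pc ->]]]] qx]; first by left.
  by right; exists (V, p) => //; exists V.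
rewrite finite_setU; split=> //; apply: finite_image.
apply: bigcup_finite => [|V _]; first exact: Dfin.
apply: sub_finite_set (finite_image (pair V) (Pfin (Dc.2 V))).
by move=> [V' p] /= [-> pP]; exists p.
Qed.

Definition refinement (P : set position) : set (set X) * (set X -> X) :=
  xget (set0, fun=> x0) (refining P).

Lemma refinementP P : good_family P -> refining P (refinement P).
Proof. by move=> /refining_ex[Dc]; exact: xgetI. Qed.

Definition positions (n : nat) : set position :=
  iter n (fun P => next_family P (refinement P)) [set ([::], setT)].

Lemma positions_good n : good_family (positions n).
Proof.
elim: n => [|n IH]; last by apply: next_family_good => //; exact: refinementP.
split=> [p ->|x]; first by left.
by apply: sub_finite_set (finite_set1 ([::], setT)) => p [].
Qed.

Definition level n : set (set X) := (refinement (positions n)).1.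

Definition pick n : set X -> X := (refinement (positions n)).2.

Lemma level_refining n : refining (positions n) (level n, pick n).
Proof.
by have := refinementP (positions_good n); rewrite /level /pick; case: refinement.
Qed.

Lemma level_open n V : level n V -> open V.
Proof. by have [[+ _] _ _] := level_refining n; apply. Qed.

Lemma level_cover n x : exists2 V, level n V & V x.
Proof.
have [[_ covE] _ _] := level_refining n.
have [V nV Vx] : cover (level n) id x by rewrite covE.
by exists V.
Qed.

Lemma level_finite n x : finite_set [set V | level n V /\ V x].
Proof. by have [_ + _] := level_refining n; apply. Qed.

Lemma level_sub n V p : level n V -> positions n p -> p.2 (pick n V) ->
  V `<=` S (rcons p.1 (pick n V, p.2)).
Proof. by have [_ _ +] := level_refining n; apply. Qed.

Lemma positions_valid n p : positions n p -> valid p.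
Proof. by have [+ _] := positions_good n; apply. Qed.

Lemma positionsS n V p : level n V -> positions n p -> p.2 (pick n V) ->
  positions n.+1 (rcons p.1 (pick n V, p.2), V).
Proof. by move=> nV np pV; right; exists V, p. Qed.

Lemma positions_mono m n : (m <= n)%N -> positions m `<=` positions n.
Proof. by move=> /subnK <-; elim: (n - m)%N => // k IH p /IH; left. Qed.

Lemma positions0 n : positions n ([::], setT).
Proof. exact: (positions_mono (leq0n n)). Qed.

(** Apply [level_sub] to the position in which Empty has played only [(pick m U, setT)] and the
    current set is [U]; Nonempty's next answer stays inside [U]. *)
Lemma level_pick_sub m n U V : (m < n)%N -> level m U -> level n V ->
  U (pick n V) -> V `<=` U.
Proof.
move=> mn mU nV UV.
pose p : position := (rcons [::] (pick m U, setT), U).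
have np : positions n p.
  by apply: (positions_mono mn); apply: (positionsS mU (positions0 m)).
apply: subset_trans (level_sub nV np UV) _.
by have [] := valid_reply (positions_valid np) UV.
Qed.

(* Every member of [level m] is reached by a play of length [m.+1] through
   members of [level 0], ..., [level m]; if infinitely many of them contained
   [x] but were not inside [W], König's lemma would give an infinite such
   play, against convergence. *)
Lemma level_development x W : nbhs x W ->
  exists N, forall n V, (N <= n)%N -> level n V -> V x -> V `<=` W.
Proof.
move=> xW; apply: contrapT => /forallNP noN.
pose L n : set position :=
  [set p | [/\ positions n p, size p.1 = n, p.2 x & ~ p.2 `<=` W]].
pose E (p q : position) := exists y, [/\ p.2 y, q.1 = rcons p.1 (y, p.2) & q.2 `<=` S q.1].
(* By this bound, a position of length [n.+1] at stage [n.+1] cannot be inherited from stage [n], so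
   it has a parent. *)
have size_positions n p : positions n p -> (size p.1 <= n)%N.
  elim: n p => [p ->//|n IH p [/IH/leqW//|[V [q [_ nq _ ->]]]]] /=.
  by rewrite size_rcons ltnS; exact: IH.
have Lpar n q : L n.+1 q -> exists2 p, L n p & E p q.
  move=> [[nq|[V [p [nV np pV ->]]]] sq qx qW].
    by have := size_positions _ _ nq; rewrite sq ltnn.
  have VS := level_sub nV np pV.
  have [_ _ Sp] := valid_reply (positions_valid np) pV.
  exists p; last by exists (pick n V).
  split=> //; first by move: sq; rewrite /= size_rcons => -[].
    exact/Sp/VS.
  by move=> pW; apply: qW; apply: subset_trans pW; exact: subset_trans VS Sp.
have full m y : exists p, [/\ positions m p, size p.1 = m & p.2 y].
  elim: m y => [y|m IH y]; first by exists ([::], setT).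
  have [V mV Vy] := level_cover m y; have [p [mp sp pV]] := IH (pick m V).
  exists (rcons p.1 (pick m V, p.2), V); split=> //; first exact: positionsS.
  by rewrite size_rcons sp.
have [|||b bP] := @konig _ L E.
- move=> n; have [_ fin] := positions_good n.
  by apply: sub_finite_set (fin x) => p [].
- exact: Lpar.
- move=> n; have [m [V [nm [mV [Vx VW]]]]] :
      exists m V, (n <= m)%N /\ level m V /\ V x /\ ~ V `<=` W.
    apply: contrapT => no; apply: (noN n) => m V nm mV Vx.
    by apply: contrapT => VW; apply: no; exists m, V.
  have [p [mp sp pV]] := full m (pick m V).
  have : L m.+1 !=set0.
    exists (rcons p.1 (pick m V, p.2), V); split=> //; first exact: positionsS.
    by rewrite size_rcons sp.
  move: nm => /leqW/subnK <-; elim: (m.+1 - n)%N => [//|k IH] [q /Lpar[q' Lq' _]].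
  by apply: IH; exists q'.
have /choice[y yP] : forall i, exists y,
    [/\ (b i).2 y, (b i.+1).1 = rcons (b i).1 (y, (b i).2) & (b i.+1).2 `<=` S (b i.+1).1].
  by move=> i; have [_ [y]] := bP i; exists y.
have bL i : L i (b i) by case: (bP i).
have [|||||_ lim] := @position_branch b y.
- by apply: size0nil; case: (bL 0%N).
- by move=> i; apply: (@positions_valid i); case: (bL i).
- by move=> i; case: (yP i).
- by move=> i; case: (yP i).
- by move=> i; case: (yP i).
have [|i bW] := lim x _ W xW; first by move=> i; case: (bL i).
by case: (bL i).
Qed.


(* For large [M] every member [U] of [level M.-1] containing [pick M (g M)]
   contains [g M], hence [x], and so is a small neighbourhood of [x]. *)
Lemma level_star x n : exists2 M, (n < M)%N & forall g : nat -> set X,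
  (forall i, level i (g i) /\ g i x) -> forall i, (i <= n)%N -> g i (pick M (g M)).
Proof.
pose W := \bigcap_(V in \bigcup_(i in `I_n.+1) [set V | level i V /\ V x]) V.
have xW : nbhs x W.
  apply: finite_bigcap_nbhs => [|V [i _ [iV Vx]]].
    by apply: bigcup_finite => [|i _]; [exact: finite_II|exact: level_finite].
  by apply: open_nbhs_nbhs; split=> //; exact: level_open iV.
have [N NP] := level_development xW.
exists (maxn N n).+1 => [|g gP i ni]; first by rewrite ltnS leq_maxr.
have [MV Vx] := gP (maxn N n).+1.
have [U mU UV] := level_cover (maxn N n) (pick (maxn N n).+1 (g (maxn N n).+1)).
have VU := level_pick_sub (ltnSn _) mU MV UV.
have [ig gx] := gP i; apply: (NP _ _ (leq_maxl _ _) mU (VU _ Vx) _ UV).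
by exists i.
Qed.

(** When every [g i] is in [level i], a hit puts [g m] inside [g 0], ..., [g n] by
    [level_pick_sub]. *)
Definition hit (g : nat -> set X) (n m : nat) :=
  (n < m)%N /\ forall i, (i <= n)%N -> g i (pick m (g m)).

Definition first_hit g n m := hit g n m /\ forall k, hit g n k -> (m <= k)%N.

Lemma first_hit_ex g n m : hit g n m -> exists2 k, (k <= m)%N & first_hit g n k.
Proof.
move=> gm; have ex : exists k, `[< hit g n k >] by exists m; apply/asboolP.
case: (ex_minnP ex) => k /asboolP gk kmin; exists k; first exact/kmin/asboolP.
by split=> // k' gk'; exact/kmin/asboolP.
Qed.

Lemma hit_ext g h n m : (forall i, (i <= m)%N -> g i = h i) -> hit g n m -> hit h n m.
Proof.
move=> gh [nm gP]; split=> // i ni; rewrite -gh ?(leq_trans ni (ltnW nm))//.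
by rewrite -gh//; exact: gP.
Qed.

(** This locality makes [thread] a closed condition and allows members beyond [m] to be replaced
    without changing the recorded hit. *)
Lemma first_hit_ext g h n m : (forall i, (i <= m)%N -> g i = h i) ->
  first_hit g n m -> first_hit h n m.
Proof.
move=> gh [gm gmin]; split=> [|k hk]; first exact: hit_ext gm.
case: (leqP m k) => // km.
have /gmin : hit g n k by apply: hit_ext hk => i ik; rewrite gh// (leq_trans ik)// ltnW.
by rewrite leqNgt km.
Qed.

Lemma first_hit_unique g n m m' : first_hit g n m -> first_hit g n m' -> m = m'.
Proof.
by move=> [gm gmin] [gm' gmin']; apply/eqP; rewrite eqn_leq gmin// gmin'.
Qed.

(* The second coordinates turn the condition "every [n] has a hit", which is
   only G_delta in the product of the discrete spaces [level n], into a closed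
   condition. *)
Definition thread (z : nat -> set X * nat) :=
  forall n, level n (z n).1 /\ first_hit (fun i => (z i).1) n (z n).2.

(* Successive first hits select a subsequence of [z] that is a play of Empty
   against [S]. *)
Lemma thread_point z : thread z -> exists x, forall n, (z n).1 x.
Proof.
move=> zP; pose k := fix k i := if i is i'.+1 then (z (k i')).2 else 0%N.
have kS i : (k i < k i.+1)%N by have [_ [[]]] := zP (k i).
have kge i : (i <= k i)%N by elim: i => [//|i IH]; exact: leq_ltn_trans (kS i).
pose y i := pick (k i) (z (k i)).1.
pose b := fix b i : position := if i is i'.+1 then
  (rcons (b i').1 (y i', (b i').2), (z (k i')).1) else ([::], setT).
have yin i j : (j <= k i)%N -> (z j).1 (y i.+1).
  by have [_ [[_ h] _]] := zP (k i); exact: h.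
have by_ i : (b i).2 (y i) by case: i => [//|i]; exact: yin.
have bpos i : positions (k i) (b i).
  elim: i => [//|i IH]; apply: (positions_mono (kS i)).
  by apply: positionsS; [case: (zP (k i))|exact: IH|exact: by_].
have [|i|//|//|i|[x bx] _] := @position_branch b y.
- by [].
- exact: positions_valid (bpos i).
- by apply: level_sub => //; case: (zP (k i)).
(* As [n <= k n], the member at index [k n.+1] lies inside the one at index [n]; it is the current
   set of [b n.+2]. *)
exists x => n; have [nV _] := zP n; have [kV _] := zP (k n.+1).
have := level_pick_sub (leq_ltn_trans (kge n) (kS n)) nV kV (yin _ _ (kge n)).
by apply; exact: (bx n.+2).
Qed.

Lemma level_point_unique (g : nat -> set X) x y : (forall n, level n (g n)) ->
  (forall n, g n x) -> (forall n, g n y) -> x = y.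
Proof.
move=> gl gx gy; apply: contrapT => xy.
have [|N NP] := @level_development x (~` [set y]).
  apply: open_nbhs_nbhs; split=> //.
  exact/closed_openC/accessible_closed_set1.
by apply: (NP N _ (leqnn N) (gl N) (gx N) y (gy N)).
Qed.

Lemma thread_ex g x : (forall n, level n (g n) /\ g n x) ->
  exists z, thread z /\ forall n, (z n).1 = g n.
Proof.
move=> gP; have /choice[m mP] : forall n, exists m, first_hit g n m.
  move=> n; have [M nM MP] := level_star x n.
  by have [|m _ gm] := @first_hit_ex g n M; [split=> //; exact: MP|exists m].
exists (fun n => (g n, m n)); split=> // n; split; first by case: (gP n).
exact: mP.
Qed.

Variable R : realType.

Definition threads := seq_space R thread.

Definition thread_map (u : threads) : X := xget x0 [set x | forall n, (sval u n).1 x].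

Lemma thread_mapP (u : threads) n : (sval u n).1 (thread_map u).
Proof.
have [x ux] := thread_point (svalP u).
have : [set x | forall n, (sval u n).1 x] x by [].
by move=> /(xgetI x0); apply.
Qed.

Lemma thread_map_eq (u : threads) x : (forall n, (sval u n).1 x) -> thread_map u = x.
Proof.
have ul n : level n (sval u n).1 by case: (svalP u n).
by move=> ux; exact: level_point_unique ul (thread_mapP u) ux.
Qed.

Lemma threads_closed (z : nat -> set X * nat) :
  (forall n, exists u : threads, forall i, (i < n)%N -> sval u i = z i) -> thread z.
Proof.
move=> zlim n; have [u uz] := zlim (maxn n (z n).2).+1.
have uE i : (i <= maxn n (z n).2)%N -> sval u i = z i by move=> ?; exact: uz.
have [] := svalP u n; rewrite uE ?leq_maxl// => nV uh; split=> //.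
by apply: first_hit_ext uh => i im; rewrite uE// (leq_trans im)// leq_maxr.
Qed.

Lemma threads_complete : complete_space threads.
Proof. exact/seq_space_complete/threads_closed. Qed.

Lemma thread_map_continuous : continuous thread_map.
Proof.
move=> u W /= uW; have [N NP] := level_development uW.
apply/seq_nbhsP; exists N.+1 => v uv /=.
have [nV _] := svalP u N; apply: (NP N _ (leqnn N) nV); first exact: thread_mapP.
by rewrite uv//; exact: thread_mapP.
Qed.

(** Let [K] bound [n] and the first [n] recorded hits of [u]. For [x] in the members of [u] up to
    [K], replacing the later ones by members containing [x] gives a thread over [x] with the same
    first [n] entries. *)
Lemma thread_map_open (A : set threads) : open A -> open (thread_map @` A).
Proof.
rewrite !openE => Ao _ [u Au <-].
have /seq_nbhsP[n nA] := Ao _ Au.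
pose K := (n + \max_(i < n) (sval u i).2)%N.
have Kge i : (i < n)%N -> ((sval u i).2 <= K)%N.
  move=> ltin; apply: leq_trans (leq_addl _ _).
  exact: (leq_bigmax (Ordinal ltin)).
apply: filterS (_ : nbhs _ (\bigcap_(i in `I_K.+1) (sval u i).1)); last first.
  apply: finite_bigcap_nbhs => [|i _]; first exact: finite_II.
  apply: open_nbhs_nbhs; split; last exact: thread_mapP.
  by have [iV _] := svalP u i; exact: level_open iV.
move=> x Kx; have /choice[h hP] : forall i, exists V, level i V /\ V x.
  by move=> i; have [V iV Vx] := level_cover i x; exists V.
pose g i := if (i <= K)%N then (sval u i).1 else h i.
have gP i : level i (g i) /\ g i x.
  rewrite /g; case: ifPn => [iK|_]; last exact: hP.
  by split; [case: (svalP u i)|exact: Kx].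
have [z [zt zg]] := thread_ex gP.
exists (exist _ z zt : threads); last by apply: thread_map_eq => i /=; rewrite zg; case: (gP i).
apply: nA => i ltin /=; have iK : (i <= K)%N by rewrite (leq_trans (ltnW ltin))// leq_addr.
have z1 : (sval u i).1 = (z i).1 by rewrite zg /g iK.
rewrite [LHS]surjective_pairing [RHS]surjective_pairing z1; congr pair.
have [_ ui] := svalP u i; have [_ zi] := zt i.
apply: first_hit_unique zi; apply: first_hit_ext ui => j ji.
by rewrite zg /g (leq_trans ji (Kge _ ltin)).
Qed.

Lemma thread_map_surj : set_surj [set: threads] [set: X] thread_map.
Proof.
move=> x _; have /choice[g gP] : forall i, exists V, level i V /\ V x.
  by move=> i; have [V iV Vx] := level_cover i x; exists V.
have [z [zt zg]] := thread_ex gP.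
exists (exist _ z zt : threads) => //; apply: thread_map_eq => i /=.
by rewrite zg; case: (gP i).
Qed.

(** Over [x], the members at level [n] form a finite set, and [level_star] bounds the recorded hits
    uniformly. *)
Lemma thread_map_compact x : compact (thread_map @^-1` [set x]).
Proof.
have /choice[M MP] : forall n, exists M, (n < M)%N /\ forall g : nat -> set X,
    (forall i, level i (g i) /\ g i x) -> forall i, (i <= n)%N -> g i (pick M (g M)).
  by move=> n; have [M] := level_star x n; exists M.
apply: (seq_space_compact threads_closed
  (A := fun n => [set V | level n V /\ V x] `*` `I_(M n).+1)) => [n|u ux n|u uK].
- by apply: finite_setX; [exact: level_finite|exact: finite_II].
- have uin i : (sval u i).1 x by rewrite -ux; exact: thread_mapP.
  have [nV [uh umin]] := svalP u n; split; first by split.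
  have [nM Mh] := MP n.
  rewrite /= ltnS; apply: umin; split=> //; apply: (Mh (fun i => (sval u i).1)) => i.
  by split; [case: (svalP u i)|exact: uin].
- suff uin n : (sval u n).1 x by exact: thread_map_eq.
  by have [v vx vu] := uK n.+1; rewrite -vu// -vx; exact: thread_mapP.
Qed.

Lemma threads_image : open_continuous_compact_image threads X.
Proof.
exists thread_map; split; [exact: thread_map_continuous|exact: thread_map_open|
  exact: thread_map_surj|exact: thread_map_compact].
Qed.

End positions.

(** * Weight *)

Definition cylinders (R : realType) (Z : Type) (P : (nat -> Z) -> Prop)
    (n : nat) : set (set (seq_space R P)) := range (@agree R Z P n).

Lemma cylinders_basis (R : realType) (Z : Type) (P : (nat -> Z) -> Prop) :
  basis (\bigcup_n @cylinders R Z P n).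
Proof.
split=> [_ [n _ [u _ <-]]|u A /seq_nbhsP[n nA]]; first exact: agree_open.
by exists (agree n u) => //; split=> //; exists n => //; exists u.
Qed.

(** For fixed [n] the cylinders partition the space into open sets, so a compact set meets finitely
    many of them. *)
Lemma cylinders_meet_compact_countable (R : realType) (Z : Type)
    (P : (nat -> Z) -> Prop) (K : set (seq_space R P)) : compact K ->
  countable [set Q | (\bigcup_n cylinders n) Q /\ Q `&` K !=set0].
Proof.
move=> Kc.
have : countable (\bigcup_n [set Q | @cylinders R Z P n Q /\ Q `&` K !=set0]).
  apply: bigcup_countable => // n _; apply: finite_set_countable.
  apply: compact_finite_meet => // u _; exists (agree n u).
    by apply/seq_nbhsP; exists n.
  apply: sub_finite_set (finite_set1 (agree n u)) => _ [[v _ <-] [w [vw uw]]].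
  have agC (a b : seq_space R P) : agree n a b -> agree n b a by move=> ab i /ab.
  by apply/seteqP; split=> a h i ltin; [rewrite uw// -vw// h|rewrite vw// -uw// h].
apply: sub_countable; apply: subset_card_le => Q [[n _ nQ] QK].
by exists n.
Qed.

Lemma open_image_basis (X Y : topologicalType) (f : Y -> X) (C : set (set Y)) :
  continuous f -> (forall U : set Y, open U -> open (f @` U)) ->
  set_surj [set: Y] [set: X] f -> basis C -> basis [set f @` V | V in C].
Proof.
move=> fcont fopen fsurj [Copen Cb]; split=> [_ [V CV <-]|x W xW].
  exact/fopen/Copen.
have [//|y _ yx] := fsurj x; rewrite -yx in xW *.
have [V [CV Vy] VW] := Cb y _ (fcont y _ xW).
exists (f @` V); first by split; [exists V|exists y].
by move=> _ [v Vv <-]; exact: VW.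
Qed.

(** Open continuous images of bases are bases, so no basis of [Y] is smaller than [B]; the basis [C]
    attains this bound. *)
Lemma same_weight_open_image (X Y : topologicalType) (f : Y -> X)
    (B : set (set X)) (C : set (set Y)) :
  continuous f -> (forall U : set Y, open U -> open (f @` U)) ->
  set_surj [set: Y] [set: X] f ->
  least_basis B -> basis C -> C #<= B -> same_weight Y X.
Proof.
move=> fcont fopen fsurj [Bb Bleast] Cb CB.
have BC (C' : set (set Y)) : basis C' -> B #<= C'.
  move=> C'b; have := Bleast _ (open_image_basis fcont fopen fsurj C'b).
  by move=> /card_le_trans; apply; exact: card_image_le.
exists C, B; split=> //; last by rewrite card_eq_le CB BC.
by split=> // C' C'b; exact: card_le_trans CB (BC _ C'b).
Qed.

Lemma least_basis_ex (X : topologicalType) : exists B : set (set X), least_basis B.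
Proof.
have [|B [Bb Bleast]] := @least_card_ex _ (@basis X); last by exists B.
exists open; split=> // x W; rewrite /= nbhsE => -[U [Uo Ux] UW].
by exists U.
Qed.

(** A finite basis would give each point a least neighbourhood, which is a singleton because points
    are closed. All singletons would then be in [B]. *)
Lemma infinite_basis (X : topologicalType) (B : set (set X)) :
  accessible_space X -> infinite_set [set: X] -> basis B -> infinite_set B.
Proof.
move=> XT1 Xinf [Bopen Bb] Bfin; apply: Xinf.
have B1 x : B [set x].
  have xN : nbhs x (\bigcap_(U in [set U | B U /\ U x]) U).
    apply: finite_bigcap_nbhs => [|U [BU Ux]].
      by apply: sub_finite_set Bfin => U [].
    by apply: open_nbhs_nbhs; split=> //; exact: Bopen.
  have [U [BU Ux] UN] := Bb x _ xN.
  suff <- : U = [set x] by [].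
  apply/seteqP; split=> [y Uy|_ ->//]; apply: contrapT => /= yx.
  have [|V [BV Vx] /(_ y)] := Bb x (~` [set y]).
    apply: open_nbhs_nbhs; split; last by move=> /esym.
    exact/closed_openC/accessible_closed_set1.
  by move=> /(_ (UN y Uy V (conj BV Vx))); apply.
apply: card_le_finite Bfin.
have inj : {in [set: X] &, injective (fun x : X => [set x])}.
  by move=> x y _ _ /= /seteqP[/(_ x erefl)].
rewrite -(card_le_eql (inj_card_eq inj)).
by apply: subset_card_le => _ [x _ <-].
Qed.

Lemma card_cylinders_le (R : realType) (Z : Type) (P : (nat -> Z) -> Prop)
    (X : topologicalType) (f : seq_space R P -> X) (B : set (set X)) :
  (forall U : set (seq_space R P), open U -> open (f @` U)) ->
  (forall x : X, compact (f @^-1` [set x])) ->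
  basis B -> infinite_set B -> \bigcup_n @cylinders R Z P n #<= B.
Proof.
move=> fopen fcomp [Bopen Bb] Binf.
apply: card_le_trans (card_setX_nat_le Binf).
(* Each cylinder's image contains a nonempty [b] in [B], and a point of [b]
   lies in the image of only countably many cylinders. *)
have /choice[e eP] : forall b : set X, exists e : nat -> set (seq_space R P),
    forall Q, (\bigcup_n cylinders n) Q -> b !=set0 -> b `<=` f @` Q -> exists k, e k = Q.
  move=> b; have [[x bx]|nb] := pselect (b !=set0); last by exists (fun=> set0) => Q _ /nb.
  have /countable_injP[h hinj] := cylinders_meet_compact_countable (fcomp x).
  have /choice[e eP] : forall k, exists Q, forall Q',
      [set Q | (\bigcup_n cylinders n) Q /\ Q `&` f @^-1` [set x] !=set0] Q' ->
      h Q' = k -> Q = Q'.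
    move=> k; set D := [set Q | _].
    have [[Q [DQ hQ]]|no] := pselect (exists Q, D Q /\ h Q = k).
      by exists Q => Q' DQ' hQ'; apply: hinj; rewrite ?inE// hQ hQ'.
    by exists set0 => Q' DQ' hQ'; case: no; exists Q'.
  exists e => Q cQ _ bQ; exists (h Q); apply: eP => //; split=> //.
  by have [u Qu ux] := bQ _ bx; exists u.
apply: card_le_trans (subset_card_le _) (card_image_le (fun bk => e bk.1 bk.2) _).
move=> Q cQ; have [n _ [u _ QE]] := cQ.
have fQ : nbhs (f u) (f @` Q).
  apply: open_nbhs_nbhs; split; first by rewrite -QE; exact/fopen/agree_open.
  by exists u; rewrite // -QE.
have [b [Bb' bu] bQ] := Bb _ _ fQ.
have [|k ek] := eP b Q cQ _ bQ; first by exists (f u).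
by exists (b, k).
Qed.

(** Treated apart because threads require a point of [X] and the cardinal estimate an infinite
    basis. Here [X] is discrete, and the constant sequences form a metric copy of it. *)
Lemma finite_space_image (R : realType) (X : topologicalType) :
  accessible_space X -> finite_set [set: X] ->
  exists Y : metricType R,
    [/\ complete_space Y, open_continuous_compact_image Y X & same_weight Y X].
Proof.
move=> XT1 Xfin.
have Xdisc (A : set X) : open A.
  rewrite -[A]setCK; apply: closed_openC; apply: (accessible_finite_set_closed.1 XT1).
  exact: sub_finite_set Xfin.
pose P (z : nat -> X) := forall n, z n = z 0%N.
pose f (u : seq_space R P) : X := sval u 0%N.
have Pclosed z : (forall n, exists u : seq_space R P,
    forall i, (i < n)%N -> sval u i = z i) -> P z.
  by move=> zlim n; have [u uz] := zlim n.+1; rewrite -!uz// (svalP u).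
have finj u v : f u = f v -> u = v.
  by move=> uv; apply: seq_space_ext => n; rewrite (svalP u) (svalP v).
have fcont : continuous f.
  move=> u W uW; apply/seq_nbhsP; exists 1%N => v uv.
  by rewrite /= /f -uv//; exact: nbhs_singleton.
have fopen (U : set (seq_space R P)) : open U -> open (f @` U) by [].
have fsurj : set_surj [set: seq_space R P] [set: X] f.
  have Pcst x : P (fun=> x) by [].
  by move=> x _; exists (exist _ _ (Pcst x) : seq_space R P).
have fcomp x : compact (f @^-1` [set x]).
  have [//|u _ <-] := fsurj x.
  suff -> : f @^-1` [set f u] = [set u] by exact: compact_set1.
  by apply/seteqP; split=> v /= => [/finj|->].
exists (seq_space R P); split; [exact: seq_space_complete|by exists f|].
have [B Bleast] := least_basis_ex X.
apply: (same_weight_open_image fcont fopen fsurj Bleast) (card_image_le (fun b => f @^-1` b) B).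
have [[Bopen Bb] _] := Bleast; split=> [_ [b Bb' <-]|u W uW].
  by apply: open_comp => [v _|]; [exact: fcont|exact: Bopen].
have [b [Bb' bu] bf] := Bb (f u) [set f u] (open_nbhs_nbhs (conj (Xdisc _) erefl)).
exists (f @^-1` b); first by split=> //; exists b.
by move=> v /= /bf /finj ->; exact: nbhs_singleton.
Qed.

Theorem theorem10 (R : realType) (X : topologicalType)
    (hX : accessible_space X) :
  ((exists Y : metricType R,
      complete_space Y /\ open_continuous_compact_image Y X) <->
   (metacompact X /\
      exists S : strategy X, convergent_winning_strategy S)) /\
  ((metacompact X /\
      exists S : strategy X, convergent_winning_strategy S) ->
   (exists S : strategy X, convergent_winning_strategy S /\ stationary S) /\
   (exists Y : metricType R,
      [/\ complete_space Y, open_continuous_compact_image Y X &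
          same_weight Y X])).
Proof.
have strat (Y : metricType R) : complete_space Y ->
    open_continuous_compact_image Y X ->
    exists S : strategy X, convergent_winning_strategy S /\ stationary S.
  by move=> Yc [f [fcont fopen fsurj fcomp]]; exact: (stationary_strategy_of_image hX Yc fcont).
have space : metacompact X /\ (exists S : strategy X, convergent_winning_strategy S) ->
    exists Y : metricType R, [/\ complete_space Y, open_continuous_compact_image Y X &
          same_weight Y X].
  move=> [Xmeta [S SP]].
  have [Xfin|Xinf] := pselect (finite_set [set: X]); first exact: finite_space_image.
  have [x0 _] := infinite_setN0 Xinf.
  exists (threads S x0 R); split.
  - exact: threads_complete.
  - exact: threads_image.
  have [B Bleast] := least_basis_ex X; have [Bb _] := Bleast.
  pose f : threads S x0 R -> X := @thread_map X S x0 R.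
  have fcont : continuous f by exact: thread_map_continuous.
  have fopen (U : set (threads S x0 R)) : open U -> open (f @` U) by exact: thread_map_open.
  have fsurj : set_surj [set: threads S x0 R] [set: X] f by exact: thread_map_surj.
  apply: (same_weight_open_image fcont fopen fsurj Bleast (@cylinders_basis _ _ _)).
  apply: (card_cylinders_le fopen _ Bb (infinite_basis hX Xinf Bb)).
  exact: thread_map_compact.
split; last first.
  move=> XS; have [Y [Yc Yim Yw]] := space XS.
  by split; [exact: strat Yc Yim|exists Y].
split=> [[Y [Yc Yim]]|/space[Y [Yc Yim _]]]; last by exists Y.
split; first exact: open_compact_image_metacompact Yim.
by have [S [SP _]] := strat _ Yc Yim; exists S.
Qed.
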